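(* Let $(\alpha,\beta)$ satisfy one of the following conditions: (I) $0<\alpha<2$, $\alpha\neq 1$, $-1<\beta<1$; (II) $1<\alpha<2$, $\beta=\pm 1$; (III) $\alpha=1$, $\beta=0$. Let $X$ be the stable process with parameters $(\alpha,\beta)$, and let $a(t)>0$ be a function of $t>0$ such that $$\frac{t}{[a(t)]^{\alpha}}\to T,\qquad t\to\infty,$$ where $0<T<\infty$. Then $$\lim_{t\to\infty}p_\alpha(t,a(t))=p_\alpha(T).$$
   Context: The stable process $X(\tau)$, $\tau\ge 0$, with parameters $(\alpha,\beta)$ is the homogeneous process with independent increments (Lévy process), $X(0)=0$, with $$E[\exp(i\xi X(\tau))]=\exp\{-\tau|\xi|^{\alpha}[1-i\beta(\mathrm{sign}\,\xi)\tan(\pi\alpha/2)]\}\quad(\alpha\neq 1),$$ $$E[\exp(i\xi X(\tau))]=\exp\{-\tau|\xi|[1+\tfrac{2i\beta}{\pi}(\mathrm{sign}\,\xi)\log|\xi|]\}\quad(\alpha=1).$$ For $t,a>0$, $p_\alpha(t,a)=P(\sup_{0\le\tau\le t}|X(\tau)|<a)$, and $p_\alpha(t)=p_\alpha(t,1)$. *)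

(* Defs.v *)
From mathcomp Require Import all_boot all_order all_algebra.
From mathcomp Require Import complex.
From mathcomp Require Import all_classical all_reals all_analysis.

Set Implicit Arguments.
Unset Strict Implicit.
Unset Printing Implicit Defensive.

Import Order.TTheory GRing.Theory Num.Theory.
Import numFieldNormedType.Exports.

Local Open Scope classical_set_scope.
Local Open Scope ring_scope.

Definition cexp (R : realType) (z : R[i]) : R[i] :=
  (expR (complex.Re z))%:C%C *
  Complex (cos (complex.Im z)) (sin (complex.Im z)).

(* Only meaningful when both components of [Z] are integrable: [fine] sends
   infinite expectations to 0. It is applied below to bounded [Z] only. *)
Definition cexpectation (d : measure_display) (Omega : measurableType d)
    (R : realType) (P : probability Omega R) (Z : Omega -> R[i]) : R[i] :=
  Complex (fine 'E_P[fun w => complex.Re (Z w)]%E)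
          (fine 'E_P[fun w => complex.Im (Z w)]%E).

(* The product rule for subfamilies is the case [B i = setT] for the omitted
   indices. *)
Definition mutually_independent (d : measure_display)
    (Omega : measurableType d) (R : realType) (P : probability Omega R)
    (n : nat) (Y : 'I_n -> Omega -> R) : Prop :=
  forall B : 'I_n -> set R, (forall i, measurable (B i)) ->
    P (\bigcap_(i in [set: 'I_n]) (Y i @^-1` B i)) =
    (\prod_(i < n) P (Y i @^-1` B i))%E.

(* Processes are indexed by [R]; only times [0 <= t] are constrained. *)
Section processes.
Context (d : measure_display) (Omega : measurableType d) (R : realType).
Variables (P : probability Omega R) (X : R -> {RV P >-> R}).

Definition independent_increments : Prop :=
  forall (n : nat) (t : nat -> R), 0 <= t 0%N ->
    (forall i, (i < n)%N -> t i < t i.+1) ->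
    mutually_independent P (fun (i : 'I_n) w => X (t i.+1) w - X (t i) w).

Definition homogeneous_increments : Prop :=
  forall (s h : R) (B : set R), 0 <= s -> 0 <= h -> measurable B ->
    P ((fun w => X (s + h) w - X s w) @^-1` B) = P (X h @^-1` B).

Definition cadlag_paths : Prop :=
  forall w : Omega,
    (forall t, 0 <= t -> X s w @[s --> t^'+] --> X t w) /\
    (forall t, 0 < t -> cvg (X s w @[s --> t^'-])).

Definition levy_process : Prop :=
  [/\ {ae P, forall w, X 0 w = 0},
      independent_increments,
      homogeneous_increments &
      cadlag_paths].

(* At [xi = 0] both branches are 0: [0 `^ alpha = 0] for [alpha != 0], and
   [ln 0 = 0]. *)
Definition stable_exponent (alpha beta xi : R) : R[i] :=
  if alpha == 1 then
    - (`|xi|%:C%C *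
       (1 + 'i%C * (2 * beta / pi * Num.sg xi * ln `|xi|)%:C%C))
  else
    - ((`|xi| `^ alpha)%:C%C *
       (1 - 'i%C * (beta * Num.sg xi * tan (pi * alpha / 2))%:C%C)).

Definition stable_process (alpha beta : R) : Prop :=
  levy_process /\
  forall tau xi : R, 0 <= tau ->
    cexpectation P (fun w => cexp ('i%C * (xi * X tau w)%:C%C)) =
    cexp (tau%:C%C * stable_exponent alpha beta xi).

(* The supremum is taken in the extended reals because the real-valued [sup]
   of an unbounded set is 0. *)
Definition sup_abs (t : R) (w : Omega) : \bar R :=
  ereal_sup [set `|X tau w|%:E | tau in `[0, t]%classic].

Definition stay_prob (t a : R) : \bar R :=
  P [set w | (sup_abs t w < a%:E)%E].

End processes.

(* Main.v *)
Require Import Defs.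
From mathcomp Require Import all_boot all_order all_algebra.
From mathcomp Require Import complex.
From mathcomp Require Import all_classical all_reals all_analysis.
From mathcomp Require Import ring lra measurable_realfun.

Set Implicit Arguments.
Unset Strict Implicit.
Unset Printing Implicit Defensive.

Import Order.TTheory GRing.Theory Num.Theory.
Import numFieldNormedType.Exports.

Local Open Scope classical_set_scope.
Local Open Scope ring_scope.

(** All admissible parameters make [X] strictly stable, so [X (c^alpha s)] and
[c X s] have the same characteristic function, hence the same law. Independence
and homogeneity of the increments carry this over to dyadic grids, and cadlag
paths to the running supremum: [p(t, a) = p(t / a^alpha, 1)]. It remains to see
that [s |-> p(s, 1)] is continuous at [T]. Right continuity comes from that of
the paths. For left continuity, [X] almost surely does not jump at [T], so a path
that stays inside [(-1, 1)] before [T] but whose supremum over [[0, T]] reaches 1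
has [|X T| = 1], which has probability 0 because the law of [X T] has no atom.

Two laws with equal characteristic functions integrate every trigonometric
polynomial alike, in particular every polynomial in [cos (b x + c)], hence the
indicator of [cos (b x + c) > 0]. With [cos (b x + c) = sin (b (x - a))] and
[b -> 0] this becomes the indicator of [x > a]. *)

(** * Polynomials that converge on [-1, 1] to the indicator of the positive numbers *)

Lemma bernoulli_inequality (R : realDomainType) (x : R) (n : nat) :
  -1 <= x -> 1 + n%:R * x <= (1 + x) ^+ n.
Proof.
move=> x1; elim: n => [|n IHn]; first by rewrite expr0 mul0r addr0.
have x10 : 0 <= 1 + x by lra.
rewrite exprS; apply: le_trans (ler_wpM2l x10 IHn).
have : 0 <= n%:R * (x * x) by rewrite mulr_ge0 // -expr2 sqr_ge0.
by rewrite -natr1; lra.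
Qed.

(** With [q] the square root of [r], each term of [1 + q + ... + q ^ (n - 1)] is at least [q ^ n],
    so [n * q ^ n * (1 - q) <= 1 - q ^ n]. Hence [n * q ^ n] is bounded and the second factor
    [q ^ n] of [r ^ n] brings the product to 0. *)
Lemma cvg_mulnX (R : realType) (r : R) : 0 <= r < 1 ->
  n%:R * r ^+ n @[n --> \oo] --> 0.
Proof.
move=> /andP[r0 r1]; pose q := Num.sqrt r.
have q0 : 0 <= q by exact: sqrtr_ge0.
have rE : r = q ^+ 2 by rewrite sqr_sqrtr.
have q1 : q < 1 by rewrite -(expr_lt1 (_ : (0 < 2)%N)) // -rE.
have bnd n : n%:R * q ^+ n * (1 - q) <= 1 - q ^+ n.
  elim: n => [|n IHn]; first by rewrite !mul0r expr0 subrr.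
  have : q ^+ n.+1 <= 1 by rewrite exprn_ile1 // ltW.
  rewrite -natr1 !exprS in IHn *; nra.
apply: (@squeeze_cvgr _ _ _ _ (cst 0) (fun n => (1 - q)^-1 * q ^+ n)).
- apply: nearW => n /=; apply/andP; split.
    by rewrite mulr_ge0 // exprn_ge0.
  rewrite rE -exprM mulnC mulnS muln1 exprD mulrA.
  apply: ler_wpM2r; first exact: exprn_ge0.
  rewrite -[leRHS]mul1r ler_pdivlMr ?subr_gt0 //; apply: le_trans (bnd n) _.
  by rewrite gerBl exprn_ge0.
- exact: cvg_cst.
- rewrite -[X in _ --> X](mulr0 (1 - q)^-1); apply: cvgM; first exact: cvg_cst.
  by apply: cvg_expr; rewrite ger0_norm.
Qed.

(* With the exponent [2 ^ n] instead of [n * 2 ^ n], the limit at [s = 0] would be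
   [expR (-1)] instead of 0. *)
Definition step_poly (R : realType) (n : nat) (s : R) : R :=
  (1 - ((1 - s) / 2) ^+ n) ^+ (n * 2 ^ n).

Lemma step_poly_bound (R : realType) (n : nat) (s : R) : `|s| <= 1 ->
  0 <= step_poly n s <= 1.
Proof.
rewrite ler_norml => /andP[s0 s1].
have [u0 u1] : 0 <= (1 - s) / 2 /\ (1 - s) / 2 <= 1 by lra.
have v0 : 0 <= ((1 - s) / 2) ^+ n by exact: exprn_ge0.
have v1 : ((1 - s) / 2) ^+ n <= 1 by exact: exprn_ile1.
by rewrite /step_poly exprn_ge0 ?exprn_ile1 //; lra.
Qed.

(** Put [u = (1 - s) / 2], [v = u ^ n] and [m = n * 2 ^ n], so that [m * v = n * (2 * u) ^ n]. If
    [s > 0], then [2 * u < 1] and Bernoulli gives [(1 - v) ^ m >= 1 - m * v], which tends to 1. If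
    [s <= 0], then [2 * u >= 1] and [(1 - v) ^ m <= 1 / (1 + v) ^ m <= 1 / (1 + m * v) <= 1 / (n +
    1)]. *)
Lemma step_poly_cvg (R : realType) (s : R) : `|s| <= 1 ->
  step_poly n s @[n --> \oo] --> ((0 < s)%R%:R : R).
Proof.
move=> hs; have bs n := step_poly_bound n hs; move: hs.
rewrite ler_norml => /andP[sN1 s1].
rewrite /step_poly in bs *; set u := (1 - s) / 2 in bs *.
have u0 : 0 <= u by rewrite /u; lra.
have u1 : u <= 1 by rewrite /u; lra.
have v0 n : 0 <= u ^+ n by exact: exprn_ge0.
have v1 n : u ^+ n <= 1 by exact: exprn_ile1.
have vE n : (n * 2 ^ n)%:R * u ^+ n = n%:R * (2 * u) ^+ n.
  by rewrite natrM natrX -mulrA -exprMn.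
have [s0|s0] := ltP 0 s.
- apply: (@squeeze_cvgr _ _ _ _ (fun n => 1 - n%:R * (2 * u) ^+ n) (cst 1)).
  + apply: nearW => n /=; case/andP: (bs n) => _ -> /=; rewrite andbT -vE.
    by rewrite -mulrN; apply: bernoulli_inequality; rewrite lerN2.
  + rewrite -[X in _ --> X]subr0; apply: cvgB; first exact: cvg_cst.
    by apply: cvg_mulnX; rewrite /u; lra.
  + exact: cvg_cst.
- apply: (@squeeze_cvgr _ _ _ _ (cst 0) (@harmonic R)).
  + apply: nearW => n /=; case/andP: (bs n) => -> _ /=.
    have nle : (n.+1)%:R <= 1 + (n * 2 ^ n)%:R * u ^+ n.
      rewrite vE -natr1 addrC lerD2l -[leLHS]mulr1 ler_wpM2l //.
      by rewrite exprn_ege1 // /u; lra.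
    rewrite -[leRHS]mul1r ler_pdivlMr ?ltr0n //.
    apply: le_trans (_ : (1 - u ^+ n) ^+ (n * 2 ^ n) * (1 + u ^+ n) ^+ (n * 2 ^ n) <= 1).
      apply: ler_wpM2l; first by rewrite exprn_ge0 // subr_ge0.
      apply: le_trans nle _; apply: bernoulli_inequality.
      by apply: le_trans (v0 n); lra.
    rewrite -exprMn; apply: exprn_ile1; have := v0 n; have := v1 n; nra.
  + exact: cvg_cst.
  + exact: cvg_harmonic.
Qed.

(** * Integrals of bounded functions against a probability *)

Section bounded_integrals.
Context (d : measure_display) (T : measurableType d) (R : realType).
Variable mu : probability T R.

Lemma bounded_integrable (f : T -> R) (M : R) :
  measurable_fun [set: T] f -> (forall x, `|f x| <= M) ->
  mu.-integrable [set: T] (EFin \o f).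
Proof.
move=> mf fM; apply: measurable_bounded_integrable => //.
  by rewrite ltey_eq fin_num_measure.
exists M; split; first by rewrite num_real.
by move=> z Mz x _; apply: le_trans (fM x) (ltW Mz).
Qed.

Lemma bounded_cvg_Rintegral (f_ : nat -> T -> R) (f : T -> R) (M : R) :
  (forall n, measurable_fun [set: T] (f_ n)) ->
  (forall n x, `|f_ n x| <= M) ->
  (forall x, f_ n x @[n --> \oo] --> f x) ->
  \int[mu]_x f_ n x @[n --> \oo] --> \int[mu]_x f x.
Proof.
move=> mf_ fM f_f.
have mf : measurable_fun [set: T] f by exact: (measurable_fun_cvg mf_).
have M0 : 0 <= M by exact: le_trans (fM 0 point).
have fM' x : `|f x| <= M.
  have cn : `|f_ n x| @[n --> \oo] --> `|f x| by apply: cvg_norm.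
  by rewrite -(cvg_lim _ cn) //; apply: limr_le; [exact: cvgP cn|exact: nearW].
have iM : mu.-integrable setT (cst M%:E).
  by apply: (@bounded_integrable (cst M) M) => // x; rewrite ger0_norm.
have [_ _ cvgI] : [/\ mu.-integrable setT (EFin \o f),
    \int[mu]_x `|(f_ n x)%:E - (f x)%:E|%E @[n --> \oo] --> 0%E &
    \int[mu]_x (f_ n x)%:E @[n --> \oo] --> \int[mu]_x (f x)%:E]%E.
  apply: dominated_convergence iM _ => //.
  - by move=> n; exact/measurable_EFinP.
  - exact/measurable_EFinP.
  - by apply: aeW => x _; apply: cvg_EFin; [exact: nearW|exact: f_f].
  - by apply: aeW => x n _ /=; rewrite lee_fin.
apply: fine_cvg; rewrite fineK; first exact: cvgI.
by apply: integrable_fin_num => //; exact: (bounded_integrable mf fM').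
Qed.

Lemma Rintegral_bool (b : T -> bool) : measurable_fun [set: T] b ->
  \int[mu]_x (b x)%:R = fine (mu [set x | b x]).
Proof.
move=> mb; have mB : measurable [set x | b x].
  by have := mb measurableT [set true] I; rewrite setTI.
rewrite -[in RHS](setIT [set x | b x]) -integral_indic // /Rintegral.
by congr fine; apply: eq_integral => x _; rewrite indicE mem_setE.
Qed.

End bounded_integrals.

(** * A law on the line is determined by its characteristic function *)

Section characteristic_function.
Context (R : realType).
Implicit Types (mu nu : probability R R) (f g : R -> R).

Lemma measurable_cos_affine (b c : R) :
  measurable_fun [set: R] (fun x => cos (b * x + c)).
Proof.
apply: continuous_measurable_fun => x.
apply: (@continuous_comp _ _ _ (fun x => b * x + c) cos); last first.
  exact: continuous_cos.
by apply: cvgD; [apply: mulrl_continuous|exact: cvg_cst].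
Qed.

Lemma measurable_cos_mul (d : measure_display) (T : measurableType d)
    (U : T -> R) (xi : R) : measurable_fun [set: T] U ->
  measurable_fun [set: T] (fun w => cos (xi * U w)).
Proof.
move=> mU; apply: (@measurableT_comp _ _ _ _ _ _ (fun x => cos (xi * x))) => //.
by have := measurable_cos_affine xi 0; under eq_fun do rewrite addr0.
Qed.

Lemma measurable_sin_mul (d : measure_display) (T : measurableType d)
    (U : T -> R) (xi : R) : measurable_fun [set: T] U ->
  measurable_fun [set: T] (fun w => sin (xi * U w)).
Proof.
move=> mU; apply: (@measurableT_comp _ _ _ _ _ _ (fun x => sin (xi * x))) => //.
have := measurable_cos_affine xi (- (pi / 2)).
by under eq_fun do rewrite cosBpihalf.
Qed.

(* Quantifying over the phase [c] covers sines as well and makes the property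
   stable under multiplication by [cos (b * x + c)]. *)
Definition same_moments mu nu g : Prop :=
  [/\ measurable_fun [set: R] g, exists M, forall x, `|g x| <= M &
      forall b c, \int[mu]_x (g x * cos (b * x + c)) =
                  \int[nu]_x (g x * cos (b * x + c))].

Lemma integrable_mul_cos mu g (M b c : R) : measurable_fun [set: R] g ->
  (forall x, `|g x| <= M) ->
  mu.-integrable [set: R] (EFin \o (fun x => g x * cos (b * x + c))).
Proof.
move=> mg gM; apply: (@bounded_integrable _ _ _ _ _ M) => [|x].
  by apply: measurable_funM => //; exact: measurable_cos_affine.
rewrite normrM; apply: le_trans (_ : M * 1 <= _); last by rewrite mulr1.
by rewrite ler_pM // cos_max.
Qed.

Lemma same_moments_lin mu nu f g (k : R) : same_moments mu nu f ->
  same_moments mu nu g -> same_moments mu nu (fun x => f x + k * g x).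
Proof.
move=> [mf [M fM] fE] [mg [N gN] gE]; split.
- by apply: measurable_funD => //; exact: measurable_funM.
- exists (M + `|k| * N) => x; apply: le_trans (ler_normD _ _) _.
  by rewrite lerD // normrM ler_wpM2l.
- move=> b c.
  have E (lambda : probability R R) :
      \int[lambda]_x ((f x + k * g x) * cos (b * x + c)) =
      \int[lambda]_x (f x * cos (b * x + c)) +
      k * \int[lambda]_x (g x * cos (b * x + c)).
    rewrite -RintegralZl //; last exact: (integrable_mul_cos _ _ _ mg gN).
    rewrite -RintegralD //.
    + by apply: eq_Rintegral => x _; rewrite mulrDl mulrA.
    + exact: (integrable_mul_cos _ _ _ mf fM).
    + apply: (@bounded_integrable _ _ _ _ _ (`|k| * N)) => [|x].
        apply: measurable_funM => //; apply: measurable_funM => //.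
        exact: measurable_cos_affine.
      rewrite normrM ler_wpM2l // normrM -[leRHS]mulr1.
      by rewrite ler_pM // cos_max.
  by rewrite !E fE gE.
Qed.

(** The product of two cosines is half the sum of the cosines of the sum and of the difference of
    the arguments, both again affine in [x]. *)
Lemma same_moments_mul_cos mu nu g (b c : R) : same_moments mu nu g ->
  same_moments mu nu (fun x => g x * cos (b * x + c)).
Proof.
move=> [mg [M gM] gE]; split.
- by apply: measurable_funM => //; exact: measurable_cos_affine.
- by exists M => x; rewrite normrM -[leRHS]mulr1 ler_pM // cos_max.
- move=> b' c'.
  have E (lambda : probability R R) :
      \int[lambda]_x (g x * cos (b * x + c) * cos (b' * x + c')) =
      2^-1 * (\int[lambda]_x (g x * cos ((b + b') * x + (c + c'))) +
              \int[lambda]_x (g x * cos ((b - b') * x + (c - c')))).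
    rewrite -RintegralD //; last 2 first.
    + exact: (integrable_mul_cos _ _ _ mg gM).
    + exact: (integrable_mul_cos _ _ _ mg gM).
    rewrite -RintegralZl //; last first.
      apply: (@bounded_integrable _ _ _ _ _ (M + M)) => [|x].
        apply: measurable_funD; apply: measurable_funM => //;
          exact: measurable_cos_affine.
      apply: le_trans (ler_normD _ _) _.
      by rewrite lerD // normrM -[leRHS]mulr1 ler_pM // cos_max.
    apply: eq_Rintegral => x _.
    have -> : (b + b') * x + (c + c') = (b * x + c) + (b' * x + c') by ring.
    have -> : (b - b') * x + (c - c') = (b * x + c) - (b' * x + c') by ring.
    by move: (b * x + c) (b' * x + c') => y z; rewrite cosB cosD; field.
  by rewrite !E !gE.
Qed.

Lemma same_moments_step_poly mu nu (n : nat) (b c : R) :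
  same_moments mu nu (cst 1) ->
  same_moments mu nu (fun x => step_poly n (cos (b * x + c))).
Proof.
move=> h1.
pose u x := (1 - cos (b * x + c)) / 2.
have mul_u g : same_moments mu nu g -> same_moments mu nu (fun x => g x * u x).
  (* [same_moments_lin] gives its first function the coefficient 1, so [(g - g * cos) / 2] is
     obtained by adding it to the zero function, itself written as [g - g]. *)
  move=> hg; have h0 : same_moments mu nu (fun x => 0 * g x).
    have := same_moments_lin (-1) hg hg.
    by congr same_moments; apply/funext => x; ring.
  have := same_moments_lin (2^-1)
    h0 (same_moments_lin (-1) hg (same_moments_mul_cos b c hg)).
  by congr same_moments; apply/funext => x; rewrite /u; field.
have mul_uX g k : same_moments mu nu g ->
    same_moments mu nu (fun x => g x * u x ^+ k).
  move=> hg; elim: k => [|k /mul_u].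
    by move: hg; congr same_moments; apply/funext => x; rewrite expr0 mulr1.
  congr same_moments; apply/funext => x; by rewrite exprSr [RHS]mulrA.
have mul_v g : same_moments mu nu g ->
    same_moments mu nu (fun x => g x * (1 - u x ^+ n)).
  move=> hg; have := same_moments_lin (-1) hg (mul_uX g n hg).
  by congr same_moments; apply/funext => x; ring.
rewrite /step_poly; elim: (n * 2 ^ n)%N => [|k /mul_v].
  by move: h1; congr same_moments; apply/funext => x; rewrite expr0.
by congr same_moments; apply/funext => x; rewrite exprSr.
Qed.

(** The addition formula takes the phase [c] out of the integral and leaves the real and imaginary
    parts of the characteristic function at [b]. *)
Lemma same_moments1 mu nu :
  (forall xi, \int[mu]_x cos (xi * x) = \int[nu]_x cos (xi * x)) ->
  (forall xi, \int[mu]_x sin (xi * x) = \int[nu]_x sin (xi * x)) ->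
  same_moments mu nu (cst 1).
Proof.
move=> hcos hsin; split; first exact: measurable_cst.
  by exists 1 => x; rewrite normr1.
move=> b c.
have mcos : measurable_fun [set: R] (fun x => cos (b * x)).
  exact: measurable_cos_mul (@measurable_id _ _ _).
have msin : measurable_fun [set: R] (fun x => sin (b * x)).
  exact: measurable_sin_mul (@measurable_id _ _ _).
have E (lambda : probability R R) :
    \int[lambda]_x (cst 1 x * cos (b * x + c)) =
    cos c * \int[lambda]_x cos (b * x) - sin c * \int[lambda]_x sin (b * x).
  have icos k : lambda.-integrable [set: R] (EFin \o (fun x => k * cos (b * x))).
    apply: (@bounded_integrable _ _ _ _ _ (`|k|)); first exact: measurable_funM.
    by move=> x; rewrite normrM -[leRHS]mulr1 ler_wpM2l // cos_max.
  have isin k : lambda.-integrable [set: R] (EFin \o (fun x => k * sin (b * x))).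
    apply: (@bounded_integrable _ _ _ _ _ (`|k|)); first exact: measurable_funM.
    by move=> x; rewrite normrM -[leRHS]mulr1 ler_wpM2l // sin_max.
  have icos1 : lambda.-integrable [set: R] (EFin \o (fun x => cos (b * x))).
    by have := icos 1; rewrite /comp; under eq_fun do rewrite mul1r.
  have isin1 : lambda.-integrable [set: R] (EFin \o (fun x => sin (b * x))).
    by have := isin 1; rewrite /comp; under eq_fun do rewrite mul1r.
  rewrite -!RintegralZl // -RintegralB //.
  by apply: eq_Rintegral => x _; rewrite /= mul1r cosD mulrC (mulrC (sin _)).
by rewrite !E hcos hsin.
Qed.

Theorem eq_characteristic_function mu nu :
  (forall xi, \int[mu]_x cos (xi * x) = \int[nu]_x cos (xi * x)) ->
  (forall xi, \int[mu]_x sin (xi * x) = \int[nu]_x sin (xi * x)) ->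
  forall A, measurable A -> mu A = nu A.
Proof.
move=> hcos hsin; have h1 := same_moments1 hcos hsin.
have half_wave (b c : R) : \int[mu]_x ((0 < cos (b * x + c))%R%:R) =
                           \int[nu]_x ((0 < cos (b * x + c))%R%:R) :> R.
  have lim (lambda : probability R R) :
      \int[lambda]_x step_poly n (cos (b * x + c)) @[n --> \oo] -->
      \int[lambda]_x ((0 < cos (b * x + c))%R%:R).
    apply: (@bounded_cvg_Rintegral _ _ _ _ _ _ 1).
    - by move=> n; have [] := same_moments_step_poly n b c h1.
    - move=> n x; have /andP[? ?] := step_poly_bound n (cos_max (b * x + c)).
      by rewrite ger0_norm.
    - by move=> x; apply: step_poly_cvg; exact: cos_max.
  have E n : \int[mu]_x step_poly n (cos (b * x + c)) =
             \int[nu]_x step_poly n (cos (b * x + c)).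
    have [_ _ /(_ 0 0)] := same_moments_step_poly n b c h1.
    by under eq_Rintegral do rewrite mul0r addr0 cos0 mulr1;
       under [in RHS]eq_Rintegral do rewrite mul0r addr0 cos0 mulr1.
  by apply: cvg_unique (lim mu) _ => //; rewrite (funext E); exact: lim.
have ray a : mu `]a, +oo[%classic = nu `]a, +oo[%classic.
  have mray : measurable_fun [set: R] (fun x => a < x).
    by apply: measurable_fun_ltr => //; exact: measurable_id.
  (* The phase makes [w n x] equal to [sin ((x - a) / (n + 1))]. Once [n + 1 > |x - a|], the
     argument lies in ]-1, 1[, within a half period on either side of 0, where the sine has the sign
     of [x - a]. *)
  pose w n x := cos (n.+1%:R^-1 * x + (- (a / n.+1%:R) - pi / 2)).
  have lim (lambda : probability R R) :
      \int[lambda]_x ((0 < w n x)%R%:R) @[n --> \oo] -->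
      \int[lambda]_x ((a < x)%R%:R).
    apply: (@bounded_cvg_Rintegral _ _ _ _ _ _ 1).
    - move=> n; apply: measurableT_comp => //=.
      by apply: measurable_fun_ltr => //; exact: measurable_cos_affine.
    - by move=> n x; case: (_ < _)%R; rewrite ?normr1 ?normr0.
    - move=> x; apply: cvg_near_cst.
      have wE n : w n x = sin ((x - a) / n.+1%:R).
        by rewrite /w addrA cosBpihalf; congr sin; ring.
      near=> n; rewrite wE.
      have n0 : 0 < n.+1%:R :> R by rewrite ltr0n.
      have nbig : `|x - a| < n.+1%:R.
        rewrite -natr1 ltr_pwDr //; near: n; exact: nbhs_infty_ger.
      have pi1 : 1 < pi :> R by apply: lt_le_trans (pi_ge2 R); lra.
      have q1 : `|(x - a) / n.+1%:R| < 1.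
        by rewrite normrM normfV (ger0_norm (ltW n0)) ltr_pdivrMr // mul1r.
      move: q1; rewrite ltr_norml => /andP[qN1 q1].
      congr (_%:R); congr nat_of_bool.
      have [ax|xa] := ltP a x.
        apply: sin_gt0_pi; rewrite divr_gt0 ?subr_gt0 //=.
        exact: lt_trans q1 pi1.
      apply/negbTE; rewrite -leNgt -oppr_ge0 -sinN; apply: sin_ge0_pi.
      rewrite oppr_ge0 pmulr_lle0 ?invr_gt0 // subr_le0 xa /= lerNl.
      by apply: le_trans (ltW qN1); rewrite lerN2 ltW.
  have : \int[mu]_x ((a < x)%R%:R) = \int[nu]_x ((a < x)%R%:R) :> R.
    apply: cvg_unique (lim mu) _ => //.
    by rewrite (funext (fun n => half_wave _ _)); exact: lim.
  rewrite !Rintegral_bool // -set_itvoy => E.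
  by rewrite -[LHS]fineK ?fin_num_measure // E fineK ?fin_num_measure.
(* Open rays to the right are stable under intersection and generate the Borel sets; the rays [g k]
   exhaust the line. *)
move=> A mA; pose g k : set R := `]- k%:R, +oo[%classic.
refine (@g_sigma_algebra_measure_unique _ R _ (@RGenOInfty.G R) _ g _ _ mu nu _ _ _ A _).
- by move=> _ [x ->]; exact: measurable_itv.
- by move=> k; exists (- k%:R).
- apply/seteqP; split=> // x _; exists (Num.truncn `|x|).+1 => //.
  rewrite /g set_itvoy /= ltrNl; apply: le_lt_trans (real_truncnS_gt (normr_real x)).
  by rewrite -normrN ler_norm.
- move=> _ _ [x ->] [y ->]; exists (Num.max x y).
  apply/seteqP; split=> z /=; rewrite !in_itv /= !andbT gt_max.
    by case=> -> ->.
  by move=> /andP[].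
- by move=> _ [x ->]; exact: ray.
- move=> k; rewrite ltey_eq fin_num_measure //; exact: measurable_itv.
- have : (@ocitv R).-sigma.-measurable A by exact: mA.
  by rewrite RGenOInfty.measurableE.
Unshelve. all: end_near.
Qed.
End characteristic_function.

(** * Equality of laws of random variables and of random vectors *)

Section laws.
Context (d : measure_display) (Omega : measurableType d) (R : realType).
Variable P : probability Omega R.

Lemma eq_law_characteristic (U V : Omega -> R) :
  measurable_fun [set: Omega] U -> measurable_fun [set: Omega] V ->
  (forall xi, \int[P]_w cos (xi * U w) = \int[P]_w cos (xi * V w)) ->
  (forall xi, \int[P]_w sin (xi * U w) = \int[P]_w sin (xi * V w)) ->
  forall A, measurable A -> P (U @^-1` A) = P (V @^-1` A).
Proof.
move=> mU mV hcos hsin.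
pose law (W : Omega -> R) (mW : measurable_fun [set: Omega] W) :=
  distribution P (mfun_Sub (mem_set mW) : {mfun Omega >-> R}).
have mcos xi : measurable_fun [set: R] (fun x => cos (xi * x)).
  exact: measurable_cos_mul (@measurable_id _ _ _).
have msin xi : measurable_fun [set: R] (fun x => sin (xi * x)).
  exact: measurable_sin_mul (@measurable_id _ _ _).
have lawE W (mW : measurable_fun [set: Omega] W) (f : R -> R) :
    measurable_fun [set: R] f -> (forall x, `|f x| <= 1) ->
    \int[law W mW]_x f x = \int[P]_w f (W w).
  move=> mf f1; rewrite /Rintegral integral_distribution //.
    exact/measurable_EFinP.
  apply: (@bounded_integrable _ _ _ _ (f \o W) 1) => [|w]; last exact: f1.
  exact: measurableT_comp.
move=> A mA; apply: (@eq_characteristic_function _ (law U mU) (law V mV)) => //.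
- by move=> xi; rewrite !(lawE _ _ (fun x => cos (xi * x))) // => x;
    exact: cos_max.
- by move=> xi; rewrite !(lawE _ _ (fun x => sin (xi * x))) // => x;
    exact: sin_max.
Qed.

(** Measurable boxes are stable under intersection and generate the product sigma-algebra: a
    cylinder over one coordinate is a box whose other sides are full. *)
Lemma eq_joint_law (n : nat) (Y Z : 'I_n -> Omega -> R) :
  (forall i, measurable_fun [set: Omega] (Y i)) ->
  (forall i, measurable_fun [set: Omega] (Z i)) ->
  (forall B : 'I_n -> set R, (forall i, measurable (B i)) ->
    P (\bigcap_(i in [set: 'I_n]) (Y i @^-1` B i)) =
    P (\bigcap_(i in [set: 'I_n]) (Z i @^-1` B i))) ->
  forall A : set (n.-tuple R), measurable A ->
    P [set w | A [tuple Y i w | i < n]] = P [set w | A [tuple Z i w | i < n]].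
Proof.
move=> mY mZ YZ.
have mtuple (W : 'I_n -> Omega -> R) :
    (forall i, measurable_fun [set: Omega] (W i)) ->
    measurable_fun [set: Omega] (fun w => [tuple W i w | i < n]).
  move=> mW; apply/measurable_fun_tnthP => i.
  by rewrite /comp; under eq_fun do rewrite tnth_mktuple; exact: mW.
pose law (W : 'I_n -> Omega -> R) mW :=
  distribution P (mfun_Sub (mem_set (mtuple W mW)) :
                   {mfun Omega >-> n.-tuple R}).
pose box (B : 'I_n -> set R) : set (n.-tuple R) :=
  [set t | forall i, B i (tnth t i)].
pose G := [set A | exists2 B, (forall i, measurable (B i)) & A = box B].
have boxE W B : [set w | box B [tuple W i w | i < n]] =
    \bigcap_(i in [set: 'I_n]) (W i @^-1` B i).
  apply/seteqP; split=> w.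
    by move=> h i _; have := h i; rewrite tnth_mktuple.
  by move=> h i; rewrite tnth_mktuple; exact: h.
have mbox B : (forall i, measurable (B i)) -> measurable (box B).
  move=> mB; rewrite (_ : box B =
      \bigcap_(i in [set: 'I_n]) ((fun t => tnth t i) @^-1` B i)); last first.
    by apply/seteqP; split=> t h i; [move=> _|]; exact: h.
  apply: fin_bigcap_measurable => // i _.
  by have := @measurable_tnth _ R n i measurableT _ (mB i); rewrite setTI.
have gen : @measurable _ (n.-tuple R) `<=` <<s G >>.
  apply: smallest_sub; first exact: smallest_sigma_algebra.
  rewrite -bigcup_seq => A [i _ [C mC <-]]; apply: sub_sigma_algebra.
  exists (fun j => if j == i then C else setT).
    by move=> j; case: eqP.
  apply/seteqP; split=> t /=.
    by move=> [_ Ct] j; case: eqP => // ->.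
  by move=> h; split=> //; have := h i; rewrite eqxx.
move=> A mA.
refine (@g_sigma_algebra_measure_unique _ R _ G _ (fun=> setT) _ _
  (law Y mY) (law Z mZ) _ _ _ A _).
- by move=> _ [B mB ->]; exact: mbox.
- by move=> _; exists (fun=> setT) => //; apply/seteqP.
- by apply/seteqP; split=> // x _; exists 0%N.
- move=> _ _ [B mB ->] [C mC ->]; exists (fun i => B i `&` C i).
    by move=> i; exact: measurableI.
  by apply/seteqP; split=> t /=; [move=> [hB hC] i|move=> h; split=> i];
    [split|have [] := h i|have [] := h i].
- by move=> _ [B mB ->]; have := YZ B mB; rewrite -!boxE.
- by move=> _; rewrite ltey_eq fin_num_measure.
- exact: gen.
Qed.

End laws.

(** * A characteristic function vanishing at infinity excludes atoms *)

Section atoms.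
Context (d : measure_display) (Omega : measurableType d) (R : realType).
Variable P : probability Omega R.

Lemma Rintegral_sum (f : nat -> Omega -> R) (n : nat) :
  (forall i, P.-integrable [set: Omega] (EFin \o f i)) ->
  \int[P]_w (\sum_(i < n) f i w) = \sum_(i < n) \int[P]_w f i w.
Proof.
move=> fi; elim: n => [|n IHn].
  under eq_Rintegral do rewrite big_ord0.
  by rewrite Rintegral_cst // mul0r big_ord0.
under eq_Rintegral do rewrite big_ord_recr.
rewrite RintegralD //; first by rewrite IHn big_ord_recr.
rewrite (_ : _ \o _ = (fun w => \sum_(i < n) (EFin \o f i) w)%E).
  exact: integrable_sum.
by apply/funext => w /=; rewrite -sumEFin.
Qed.

(** Both sides are the squared modulus of the sum of the [exp (i x_j)]; the right one shows that the
    double sum is nonnegative. *)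
Lemma sum_cosB (n : nat) (x : nat -> R) :
  \sum_(j < n) \sum_(k < n) cos (x j - x k) =
  (\sum_(j < n) cos (x j)) ^+ 2 + (\sum_(j < n) sin (x j)) ^+ 2.
Proof.
rewrite !expr2 !big_distrlr -big_split /=; apply: eq_bigr => j _.
by rewrite -big_split /=; apply: eq_bigr => k _; rewrite cosB.
Qed.

(* [`|\sum_(j < n) expR (i j K (U - c))| ^+ 2] is [n ^+ 2] on the atom, while its
   expectation is about [n] for large [K]: only the diagonal terms survive. *)
Lemma no_atom (U : Omega -> R) : measurable_fun [set: Omega] U ->
  (forall e, 0 < e -> exists2 K, 0 < K & forall xi, K <= `|xi| ->
    `|\int[P]_w cos (xi * U w)| <= e /\ `|\int[P]_w sin (xi * U w)| <= e) ->
  forall c, P [set w | U w = c] = 0%E.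
Proof.
move=> mU decay c; set A := [set w | U w = c].
have mb : measurable_fun [set: Omega] (fun w => U w == c).
  apply: measurable_fun_eqr => //; exact: measurable_cst.
have mbR : measurable_fun [set: Omega] (fun w => (U w == c)%:R : R).
  exact: (@measurableT_comp _ _ _ _ _ _ (fun b : bool => b%:R : R)).
have AE : A = [set w | U w == c] by apply/seteqP; split=> w /= /eqP.
have mA : measurable A.
  by rewrite AE; have := mb measurableT [set true] I; rewrite setTI.
pose p := fine (P A).
suff p0 : p <= 0.
  have : p = 0 by apply/eqP; rewrite eq_le p0 fine_ge0.
  by rewrite /p => pE; rewrite -[LHS]fineK ?fin_num_measure // pE.
rewrite leNgt; apply/negP => p_gt0.
(* For [j != k] the frequency [(j - k) * K] is at least [K] in absolute value. After expanding the
   shift by [c], the cosine and the sine part each contribute at most [p / 4], so an off-diagonal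
   term is at most [p / 2]. *)
have [K K0 hK] := decay (p / 4) (divr_gt0 p_gt0 (ltr0n _ 4)).
pose V xi w := cos (xi * (U w - c)).
have VE xi w : V xi w = cos (xi * c) * cos (xi * U w) + sin (xi * c) * sin (xi * U w).
  by rewrite /V mulrBr cosB mulrC [X in _ + X]mulrC.
have mV xi : measurable_fun [set: Omega] (V xi).
  by apply: measurable_cos_mul; exact: measurable_funB.
have iV xi : P.-integrable [set: Omega] (EFin \o V xi).
  by apply: (@bounded_integrable _ _ _ _ _ 1) => // w; exact: cos_max.
have V_le xi : K <= `|xi| -> \int[P]_w V xi w <= p / 2.
  move=> /hK [hc hs].
  have ic : P.-integrable [set: Omega] (EFin \o (fun w => cos (xi * U w))).
    apply: (@bounded_integrable _ _ _ _ _ 1) => [|w]; last exact: cos_max.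
    exact: measurable_cos_mul.
  have is_ : P.-integrable [set: Omega] (EFin \o (fun w => sin (xi * U w))).
    apply: (@bounded_integrable _ _ _ _ _ 1) => [|w]; last exact: sin_max.
    exact: measurable_sin_mul.
  under eq_Rintegral do rewrite VE.
  rewrite RintegralD //; last 2 first.
  - apply: (@bounded_integrable _ _ _ _ _ 1) => [|w].
      by apply: measurable_funM => //; exact: measurable_cos_mul.
    by rewrite normrM -[leRHS]mulr1 ler_pM // cos_max.
  - apply: (@bounded_integrable _ _ _ _ _ 1) => [|w].
      by apply: measurable_funM => //; exact: measurable_sin_mul.
    by rewrite normrM -[leRHS]mulr1 ler_pM // sin_max.
  rewrite !RintegralZl // (_ : p / 2 = p / 4 + p / 4); last by field.
  apply: lerD; apply: le_trans (ler_norm _) _; rewrite normrM -[leRHS]mul1r;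
    by rewrite ler_pM ?cos_max ?sin_max.
have bound n : n%:R ^+ 2 * p <= n%:R + n%:R ^+ 2 * (p / 2).
  pose S w := \sum_(j < n) \sum_(k < n) V ((j%:R - k%:R) * K) w.
  have SE w : S w = (\sum_(j < n) cos (j%:R * K * (U w - c))) ^+ 2 +
                    (\sum_(j < n) sin (j%:R * K * (U w - c))) ^+ 2.
    rewrite -(sum_cosB n (fun j => j%:R * K * (U w - c))).
    by apply: eq_bigr => j _; apply: eq_bigr => k _; rewrite /V; congr cos; ring.
  have iS1 j : P.-integrable [set: Omega]
      (EFin \o (fun w => \sum_(k < n) V ((j%:R - k%:R) * K) w)).
    rewrite (_ : _ \o _ = (fun w => \sum_(k < n) (EFin \o V ((j%:R - k%:R) * K)%R) w)%E).
      exact: integrable_sum.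
    by apply/funext => w /=; rewrite -sumEFin.
  have iS : P.-integrable [set: Omega] (EFin \o S).
    rewrite (_ : _ \o _ = (fun w => \sum_(j < n)
      (EFin \o (fun w => \sum_(k < n) V ((j%:R - k%:R) * K) w)%R) w)%E).
      exact: integrable_sum.
    by apply/funext => w /=; rewrite -sumEFin.
  have S_ge : n%:R ^+ 2 * p <= \int[P]_w S w.
    have ib : P.-integrable [set: Omega] (EFin \o (fun w => (U w == c)%:R : R)).
      apply: (@bounded_integrable _ _ _ _ _ 1) => // w.
      by case: eqP; rewrite ?normr1 ?normr0.
    rewrite /p AE -Rintegral_bool // -RintegralZl //.
    apply: le_Rintegral => //.
      apply: (@bounded_integrable _ _ _ _ _ (n%:R ^+ 2)) => [|w].
        exact: measurable_funM.
      rewrite normrM ger0_norm ?sqr_ge0 // -[leRHS]mulr1 ler_wpM2l ?sqr_ge0 //.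
      by case: eqP; rewrite ?normr1 ?normr0.
    move=> w _; case: eqP => [Uc|_]; last first.
      by rewrite mulr0 SE addr_ge0 // sqr_ge0.
    rewrite mulr1 SE Uc subrr.
    under eq_bigr do rewrite mulr0 cos0.
    by rewrite sumr_const card_ord lerDl sqr_ge0.
  have S_le : \int[P]_w S w <= n%:R + n%:R ^+ 2 * (p / 2).
    rewrite (Rintegral_sum (f := fun j w => \sum_(k < n) V ((j%:R - k%:R) * K) w)) //.
    (* The diagonal terms equal 1 and are bounded by [1 + p / 2], which gives all entries one common
       form. *)
    apply: le_trans (_ : \sum_(j < n) \sum_(k < n) ((j == k)%:R + p / 2) <= _).
      apply: ler_sum => j _.
      rewrite (Rintegral_sum (f := fun k => V ((j%:R - k%:R) * K))) //.
      apply: ler_sum => k _; have [->|jk] := eqVneq j k.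
        rewrite /V; under eq_Rintegral do rewrite subrr !mul0r cos0.
        rewrite Rintegral_cst // [X in fine X](probability_setT P) /= mulr1 lerDl.
        by rewrite divr_ge0 ?ltW.
      rewrite add0r; apply: V_le; rewrite normrM (gtr0_norm K0) ler_peMl ?(ltW K0) //.
      have {}jk : (j : nat) != k by [].
      move: jk; rewrite neq_ltn => /orP[jk|kj].
        by rewrite distrC -natrB ?(ltnW jk) // normr_nat ler1n subn_gt0.
      by rewrite -natrB ?(ltnW kj) // normr_nat ler1n subn_gt0.
    under eq_bigr => j _.
      rewrite big_split /= sumr_const card_ord (bigD1 j) //= eqxx big1 ?addr0.
        over.
      by move=> k kj; rewrite eq_sym (negPf kj).
    rewrite sumr_const card_ord -(mulr_natl (p / 2)) -(mulr_natl (1 + _)).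
    by rewrite mulrDr mulr1 mulrA -expr2.
  exact: le_trans S_ge S_le.
(* [bound] amounts to [n ^ 2 * p / 2 <= n], which fails as soon as [n * p > 2]. *)
pose n := (Num.truncn (2 / p)).+1.
have n_gt : 2 < n%:R * p.
  by rewrite -ltr_pdivrMr //; exact/real_truncnS_gt/num_real.
have n0 : 0 < n%:R :> R by rewrite ltr0n.
have := bound n; nra.
Qed.

End atoms.

(** * Scaling and absence of atoms for the stable laws *)

Section stable_characteristic_function.
Context (d : measure_display) (Omega : measurableType d) (R : realType).
Variables (P : probability Omega R) (alpha beta : R) (X : R -> {RV P >-> R}).

(** The power [|xi| ^ alpha] is homogeneous and the sign of [xi] is unchanged by a positive factor.
    At [alpha = 1] the logarithm would break the scaling, and [beta = 0] removes it. *)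
Lemma stable_exponent_scale (c xi : R) : 0 < c -> (alpha = 1 -> beta = 0) ->
  (c `^ alpha)%:C%C * stable_exponent alpha beta xi =
  stable_exponent alpha beta (c * xi).
Proof.
have realM (x y : R) : (x * y)%:C%C = x%:C%C * y%:C%C by rewrite rmorphM.
move=> c0 hab; rewrite /stable_exponent normrM (gtr0_norm c0).
have [a1|a1] := eqVneq alpha 1.
  by rewrite a1 powRr1 ?(ltW c0) // hab // !(mulr0, mul0r, rmorph0) addr0 !mulr1 realM mulrN.
by rewrite sgrM (gtr0_sg c0) mul1r powRM ?(ltW c0) // (realM (c `^ _)) mulrN mulrA.
Qed.

Lemma Re_stable_exponent (xi : R) : (alpha = 1 -> beta = 0) ->
  complex.Re (stable_exponent alpha beta xi) = - (`|xi| `^ alpha).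
Proof.
move=> hab; rewrite /stable_exponent; case: eqVneq => [a1|a1].
  rewrite a1 hab // powRr1 // !(mulr0, mul0r); simpc.
  by rewrite /=; ring.
by simpc; rewrite /=; ring.
Qed.

Hypothesis hX : stable_process X alpha beta.

Lemma cexp_imaginary (r : R) : cexp ('i%C * r%:C%C) = Complex (cos r) (sin r).
Proof.
rewrite /cexp; simpc; rewrite /= expR0; simpc.
by [].
Qed.

Lemma stable_cos_sin (t xi : R) : 0 <= t ->
  \int[P]_w cos (xi * X t w) = complex.Re (cexp (t%:C%C * stable_exponent alpha beta xi)) /\
  \int[P]_w sin (xi * X t w) = complex.Im (cexp (t%:C%C * stable_exponent alpha beta xi)).
Proof.
move=> t0; have [_ /(_ t xi t0)] := hX.
have -> : (fun w => cexp ('i%C * (xi * X t w)%:C%C)) =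
    (fun w => Complex (cos (xi * X t w)) (sin (xi * X t w))).
  by apply/funext => w; exact: cexp_imaginary.
by rewrite /cexpectation unlock => <-.
Qed.

Hypothesis hab : alpha = 1 -> beta = 0.

(** Both characteristic functions are the exponential of [s] times the stable exponent at
    [c * xi]. *)
Lemma stable_scaling (s c : R) : 0 <= s -> 0 < c ->
  forall A, measurable A ->
    P (X (s * c `^ alpha) @^-1` A) = P ((fun w => c * X s w) @^-1` A).
Proof.
move=> s0 c0; have sc0 : 0 <= s * c `^ alpha by rewrite mulr_ge0 // powR_ge0.
have E xi : (s * c `^ alpha)%:C%C * stable_exponent alpha beta xi =
    s%:C%C * stable_exponent alpha beta (xi * c).
  by rewrite mulrC [xi * c]mulrC -stable_exponent_scale // mulrA -rmorphM mulrC.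
apply: eq_law_characteristic => // [|xi|xi].
- by apply: measurable_funM => //; exact: measurable_cst.
- rewrite (proj1 (stable_cos_sin xi sc0)) E -(proj1 (stable_cos_sin (xi * c) s0)).
  by apply: eq_Rintegral => w _; rewrite mulrA.
- rewrite (proj2 (stable_cos_sin xi sc0)) E -(proj2 (stable_cos_sin (xi * c) s0)).
  by apply: eq_Rintegral => w _; rewrite mulrA.
Qed.

Lemma cexp_bound (z : R[i]) :
  `|complex.Re (cexp z)| <= expR (complex.Re z) /\
  `|complex.Im (cexp z)| <= expR (complex.Re z).
Proof.
rewrite /cexp; simpc; rewrite /=.
by rewrite !normrM !(gtr0_norm (expR_gt0 _)) !ler_piMr ?expR_ge0 ?cos_max ?sin_max.
Qed.

(** The characteristic function has modulus [exp (- t * |xi| ^ alpha)], which tends to 0. *)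
Lemma stable_no_atom (t c : R) : 0 < alpha -> 0 < t -> P [set w | X t w = c] = 0%E.
Proof.
move=> a0 t0; apply: no_atom => // e e0.
(* For [e < 1] the second argument solves [exp (- t * K ^ alpha) = e]. For [e >= 1] every [xi]
   serves; the maximum with 1 keeps [K] positive in all cases. *)
pose K := Num.max 1 ((- ln e / t) `^ alpha^-1).
exists K; first by rewrite lt_max ltr01.
move=> xi hK; have [-> ->] := stable_cos_sin xi (ltW t0).
have le_e : expR (complex.Re (t%:C%C * stable_exponent alpha beta xi)) <= e.
  have -> : complex.Re (t%:C%C * stable_exponent alpha beta xi) =
      - (t * `|xi| `^ alpha).
    have := Re_stable_exponent xi hab; case: (stable_exponent _ _ _) => x y /= ->.
    by rewrite mul0r subr0 mulrN.
  rewrite -[leRHS]lnK ?posrE // ler_expR lerNl -ler_pdivrMl // mulrC.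
  have [le0|gt0] := leP (- ln e / t) 0.
    by apply: le_trans le0 _; exact: powR_ge0.
  have -> : - ln e / t = ((- ln e / t) `^ alpha^-1) `^ alpha.
    by rewrite -powRrM mulVf ?gt_eqF // powRr1 // ltW.
  apply: ge0_ler_powR; rewrite ?nnegrE ?powR_ge0 ?(ltW a0) //.
  by apply: le_trans hK; rewrite le_max lexx orbT.
have [hR hI] := cexp_bound (t%:C%C * stable_exponent alpha beta xi).
by split; [apply: le_trans hR _|apply: le_trans hI _].
Qed.

End stable_characteristic_function.

(** * The running supremum through dyadic grids *)

Section running_supremum.
Context (d : measure_display) (Omega : measurableType d) (R : realType).
Variables (P : probability Omega R) (X : R -> {RV P >-> R}).

(** The bound is weak because even strict bounds at all grid points would give only a weak bound on
    the supremum. *)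
Definition grid_event (t c : R) (n : nat) : set Omega :=
  [set w | forall k, (k <= 2 ^ n)%N -> `|X (k%:R * (t / 2 ^+ n)) w| <= c].

Lemma measurable_abs_le (U : Omega -> R) (c : R) : measurable_fun [set: Omega] U ->
  measurable [set w | `|U w| <= c].
Proof.
move=> mU; have mb : measurable_fun [set: Omega] (fun w => `|U w| <= c).
  by apply: measurable_fun_ler => //; exact: measurableT_comp.
by have := mb measurableT [set true] I; rewrite setTI.
Qed.

Lemma measurable_grid_event (t c : R) (n : nat) : measurable (grid_event t c n).
Proof.
rewrite (_ : grid_event t c n = \bigcap_(k in [set k | (k <= 2 ^ n)%N])
    [set w | `|X (k%:R * (t / 2 ^+ n)) w| <= c]); last first.
  by apply/seteqP; split=> w h k; exact: h.
by apply: bigcap_measurableType => k _; exact: measurable_abs_le.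
Qed.

Lemma grid_event_nonincreasing (t c : R) : nonincreasing_seq (grid_event t c).
Proof.
move=> m n mn; apply/subsetPset => w Gn k km.
have -> : k%:R * (t / 2 ^+ m) = (k * 2 ^ (n - m))%:R * (t / 2 ^+ n) :> R.
  rewrite natrM natrX -{2}(subnK mn) exprD.
  have p0 j : 2 ^+ j != 0 :> R by rewrite expf_neq0.
  by field; rewrite !p0.
by apply: Gn; rewrite -(subnKC mn) expnD addKn leq_mul2r km orbT.
Qed.

Lemma sup_abs_leP (t : R) (w : Omega) (c : \bar R) :
  (sup_abs X t w <= c)%E <-> (forall s, 0 <= s <= t -> (`|X s w|%:E <= c)%E).
Proof.
split=> [h s st|h].
  by apply: le_trans h; apply: ereal_sup_ubound; exists s.
by apply: ge_ereal_sup => _ [s st <-]; apply: h; move: st; rewrite /= in_itv.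
Qed.

Hypothesis cad : cadlag_paths X.

(** By right continuity, a path that exceeds [c] at some [s < t] exceeds it on an interval to the
    right of [s], and a fine enough grid has a point there. *)
Lemma sup_abs_le_grid (t c : R) : 0 < t ->
  [set w | (sup_abs X t w <= c%:E)%E] = \bigcap_n grid_event t c n.
Proof.
move=> t0; have h0 n : 0 < t / 2 ^+ n by rewrite divr_gt0 // exprn_gt0.
apply/seteqP; split=> w /=.
  move=> /sup_abs_leP h n _ k kn; rewrite -lee_fin; apply: h.
  rewrite mulr_ge0 ?(ltW (h0 n)) //= mulrA ler_pdivrMr ?exprn_gt0 // mulrC.
  by rewrite ler_wpM2l ?(ltW t0) // -natrX ler_nat.
move=> h; apply/sup_abs_leP => s /andP[s0 st]; rewrite lee_fin.
(* Right continuity says nothing within [0, t] at the endpoint [t], but [t] is the grid point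
   [k = 1] of level 0. *)
move: st; rewrite le_eqVlt => /predU1P[->|st].
  by have := h 0%N I 1%N isT; rewrite expr0 divr1 mul1r.
rewrite leNgt; apply/negP => cs.
have [/(_ s s0) rc _] := cad w.
have [e /= e0 he] : \forall u \near s^'+, c < `|X u w|.
  by apply: (cvgr_gt `|X s w|) cs; exact: cvg_norm.
(* A point of ]s, s + m[ lies both in the interval where the path exceeds [c] and before [t]. *)
pose m := Num.min e (t - s).
have m0 : 0 < m by rewrite lt_min e0 subr_gt0.
have [n hn] : exists n, t / 2 ^+ n < m.
  have : t * (2^-1) ^+ n @[n --> \oo] --> t * 0.
    apply: cvgM; first exact: cvg_cst.
    by apply: cvg_expr; rewrite ger0_norm // invf_lt1 // ltr1n.
  rewrite mulr0 => /(_ _ (lt_nbhsl m0)) [n _ /(_ n (leqnn n)) /=].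
  by rewrite exprVn => hn; exists n; exact: hn.
(* The first grid index strictly beyond [s], hence at most one mesh away from it. *)
pose k := (Num.truncn (s / (t / 2 ^+ n))).+1.
have kgt : s < k%:R * (t / 2 ^+ n).
  by rewrite -ltr_pdivrMr //; exact/real_truncnS_gt/num_real.
have kle : k%:R * (t / 2 ^+ n) <= s + t / 2 ^+ n.
  rewrite /k -natr1 mulrDl mul1r lerD2r -ler_pdivlMr // truncn_le.
  by rewrite divr_ge0 // ltW.
have klt : k%:R * (t / 2 ^+ n) < s + m by apply: le_lt_trans kle _; rewrite ltrD2l.
have kn : (k <= 2 ^ n)%N.
  have nE : 2 ^+ n * (t / 2 ^+ n) = t by rewrite mulrC divfK // expf_neq0.
  rewrite ltnW // -(ltr_nat R) natrX -(ltr_pM2r (h0 n)) nE.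
  by apply: lt_le_trans klt _; rewrite -lerBrDl ge_min lexx orbT.
have := h n I k kn; apply/negP; rewrite -ltNge; apply: he => //=.
rewrite ltr0_norm ?subr_lt0 // opprB ltrBlDl; apply: lt_le_trans klt _.
by rewrite lerD2l ge_min lexx.
Qed.

(** Writing the strict event as an increasing union of weak ones gives access to the grids. The
    levels are proportional to [a], so that scaling respects them. *)
Lemma sup_abs_lt_bigcup (t a : R) : 0 <= t -> 0 < a ->
  [set w | (sup_abs X t w < a%:E)%E] =
  \bigcup_m [set w | (sup_abs X t w <= (a * (1 - m.+1%:R^-1))%:E)%E].
Proof.
move=> t0 a0; apply/seteqP; split=> w /=.
  have : (0 <= sup_abs X t w)%E.
    apply: le_trans (_ : `|X 0 w|%:E <= _)%E; first by rewrite lee_fin.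
    by apply: ereal_sup_ubound; exists 0 => //=; rewrite in_itv /= lexx.
  case E: (sup_abs X t w) => [r| |] //=; rewrite lee_fin lte_fin => r0 ra.
  (* This index satisfies [a / (m + 1) <= a - r]. *)
  exists (Num.truncn (a / (a - r))) => //=; rewrite E lee_fin.
  rewrite mulrBr mulr1 lerBrDl -lerBrDr ler_pdivrMr ?ltr0n //.
  rewrite -ler_pdivrMl ?subr_gt0 // mulrC.
  by rewrite ltW //; exact/real_truncnS_gt/num_real.
by move=> [m _] /le_lt_trans; apply; rewrite lte_fin gtr_pMr // gtrBl invr_gt0.
Qed.

Lemma measurable_sup_abs_lt (t a : R) : 0 < t -> 0 < a ->
  measurable [set w | (sup_abs X t w < a%:E)%E].
Proof.
move=> t0 a0; rewrite sup_abs_lt_bigcup ?(ltW t0) //.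
apply: bigcupT_measurable => m; rewrite sup_abs_le_grid //.
by apply: bigcapT_measurable => n; exact: measurable_grid_event.
Qed.

End running_supremum.

(** * Self-similarity of the probability of staying in an interval *)

Section scaling.
Context (d : measure_display) (Omega : measurableType d) (R : realType).
Variables (P : probability Omega R) (X : R -> {RV P >-> R}).

Lemma le_measure_null (A B N : set Omega) : measurable A -> measurable B ->
  measurable N -> P N = 0%E -> A `<=` B `|` N -> (P A <= P B)%E.
Proof.
move=> mA mB mN N0 AB; rewrite -(measureU0 mB mN N0).
by apply: le_measure; rewrite ?inE //; exact: measurableU.
Qed.

(** The grid event as a condition on the vector of increments, the form to which [eq_joint_law]
    applies. *)
Definition partial_sums_bounded (N : nat) (c : R) : set (N.-tuple R) :=
  [set y | forall k, (k <= N)%N -> `|\sum_(i < N | (i < k)%N) tnth y i| <= c].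

Lemma measurable_partial_sums_bounded (N : nat) (c : R) :
  measurable (@partial_sums_bounded N c).
Proof.
rewrite (_ : @partial_sums_bounded N c = \bigcap_(k in [set k | (k <= N)%N])
    [set y | `|\sum_(i < N | (i < k)%N) tnth y i| <= c]); last first.
  by apply/seteqP; split=> y h k; exact: h.
apply: bigcap_measurableType => k _; apply: measurable_abs_le.
under eq_fun do rewrite big_mkcond.
apply: measurable_sum => i; case: (i < k)%N; last exact: measurable_cst.
exact: measurable_tnth.
Qed.

Definition increment (h : R) (i : nat) (w : Omega) : R :=
  X (i.+1%:R * h) w - X (i%:R * h) w.

Lemma measurable_increment (h : R) (i : nat) :
  measurable_fun [set: Omega] (increment h i).
Proof. exact: measurable_funB. Qed.

Lemma measurable_mktuple (N : nat) (Y : 'I_N -> Omega -> R) (A : set (N.-tuple R)) :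
  (forall i, measurable_fun [set: Omega] (Y i)) -> measurable A ->
  measurable [set w | A [tuple Y i w | i < N]].
Proof.
move=> mY mA; have mt : measurable_fun [set: Omega] (fun w => [tuple Y i w | i < N]).
  apply/measurable_fun_tnthP => i.
  by rewrite /comp; under eq_fun do rewrite tnth_mktuple; exact: mY.
by have := mt measurableT A mA; rewrite setTI.
Qed.

(** The increments telescope to [X (k * h) - X 0], and [X 0] vanishes off a null set. *)
Lemma grid_event_increments (t c : R) (n : nat) : {ae P, forall w, X 0 w = 0} ->
  P (grid_event X t c n) =
  P [set w | partial_sums_bounded c
               [tuple increment (t / 2 ^+ n) i w | i < 2 ^ n]].
Proof.
move=> [N [mN N0 X0]]; set h := t / 2 ^+ n.
have sumE k w : (k <= 2 ^ n)%N -> ~ N w ->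
    \sum_(i < 2 ^ n | (i < k)%N) tnth [tuple increment h i w | i < 2 ^ n] i =
    X (k%:R * h) w.
  move=> kn Nw; under eq_bigr do rewrite tnth_mktuple.
  rewrite -(big_ord_widen _ (fun i => increment h i w) kn).
  rewrite -(big_mkord xpredT (fun i => increment h i w)).
  rewrite (telescope_sumr (fun i => X (i%:R * h) w)) // mul0r.
  have -> : X 0 w = 0 by apply: contrapT => X0w; apply: Nw; exact: X0.
  by rewrite subr0.
have mG := measurable_grid_event X t c n.
have mT := measurable_mktuple (fun i : 'I_(2 ^ n) => measurable_increment h i)
  (@measurable_partial_sums_bounded (2 ^ n) c).
apply/eqP; rewrite eq_le; apply/andP; split;
  apply: (@le_measure_null _ _ N) => // w hw;
  (have [Nw|Nw] := pselect (N w); [by right|left]) => k kn.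
- by rewrite sumE //; exact: hw.
- by have := hw k kn; rewrite sumE.
Qed.

Variables (alpha beta : R).
Hypothesis hX : stable_process X alpha beta.
Hypothesis hab : alpha = 1 -> beta = 0.

Lemma increment_law (h : R) (i : nat) (B : set R) : 0 <= h -> measurable B ->
  P (increment h i @^-1` B) = P (X h @^-1` B).
Proof.
move=> h0 mB; have [[_ _ hom _] _] := hX.
rewrite -(hom (i%:R * h) h B) ?mulr_ge0 //; congr (P (_ @^-1` B)).
by apply/funext => w; rewrite /increment -natr1 mulrDl mul1r.
Qed.

Lemma increments_independent (h : R) (N : nat) (B : 'I_N -> set R) : 0 < h ->
  (forall i, measurable (B i)) ->
  P (\bigcap_(i in [set: 'I_N]) (increment h i @^-1` B i)) =
  (\prod_(i < N) P (X h @^-1` B i))%E.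
Proof.
move=> h0 mB; have [[_ ind _ _] _] := hX.
have := ind N (fun i => i%:R * h); rewrite mul0r => /(_ (lexx 0)) indN.
rewrite (indN _ B) //; last first.
  by move=> i _; rewrite ltr_pM2r // ltr_nat.
by apply: eq_bigr => i _; apply: increment_law; rewrite ?ltW.
Qed.

(** The increments over mesh [h], divided by [a], are independent with the law of
    [X (h / a ^ alpha)]. These are the independence and the marginals of the increments over mesh
    [h'], so the joint laws agree. *)
Lemma grid_event_scaling (t a c : R) (n : nat) : 0 < t -> 0 < a ->
  P (grid_event X t (a * c) n) = P (grid_event X (t / a `^ alpha) c n).
Proof.
move=> t0 a0; have [[X0 _ _ _] _] := hX.
have aa0 : 0 < a `^ alpha by exact: powR_gt0.
have an0 : a != 0 by rewrite gt_eqF.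
rewrite !grid_event_increments //.
set h := t / 2 ^+ n; set h' := t / a `^ alpha / 2 ^+ n.
have h0 : 0 < h by rewrite divr_gt0 // exprn_gt0.
have h'0 : 0 < h' by rewrite !divr_gt0 // exprn_gt0.
have hE : h' * a `^ alpha = h.
  by rewrite /h' /h mulrAC divfK // gt_eqF.
pose Y (i : 'I_(2 ^ n)) w := a^-1 * increment h i w.
have mY i : measurable_fun [set: Omega] (Y i).
  by apply: measurable_funM => //; exact: measurable_increment.
transitivity (P [set w | partial_sums_bounded c [tuple Y i w | i < 2 ^ n]]).
  congr (P _); apply/seteqP.
  have E w k : \sum_(i < 2 ^ n | (i < k)%N) tnth [tuple Y i w | i < 2 ^ n] i =
      a^-1 * \sum_(i < 2 ^ n | (i < k)%N)
        tnth [tuple increment h i w | i < 2 ^ n] i.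
    by rewrite mulr_sumr; apply: eq_bigr => i _; rewrite !tnth_mktuple.
  split=> w hw k kn; have := hw k kn; rewrite E normrM (gtr0_norm (_ : 0 < a^-1))
    ?invr_gt0 // ler_pdivrMl //.
apply: eq_joint_law => // [i||]; [exact: measurable_increment| |]; last first.
  exact: measurable_partial_sums_bounded.
move=> B mB; rewrite increments_independent //.
have mB' i : measurable ((fun y => a^-1 * y) @^-1` B i).
  by have := @measurable_funM _ _ R setT (cst a^-1) id
    (measurable_cst _) (@measurable_id _ _ _) measurableT _ (mB i); rewrite setTI.
rewrite (increments_independent (B := fun i => (fun y => a^-1 * y) @^-1` B i)) //.
apply: eq_bigr => i _; rewrite -hE (stable_scaling hX) // ?(ltW h'0) //.
by congr (P _); apply/seteqP; split=> w; rewrite /preimage /= mulKf.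
Qed.

Lemma cadlag_stable : cadlag_paths X.
Proof. by have [[]] := hX. Qed.

(** Two monotone limits carry the scaling over from the grids: a decreasing one in the level [n]
    reaches the weak events, an increasing one in [m] the strict event. *)
Lemma stay_prob_scaling (t a : R) : 0 < t -> 0 < a ->
  stay_prob X t a = stay_prob X (t / a `^ alpha) 1.
Proof.
move=> t0 a0; have ta0 : 0 < t / a `^ alpha by rewrite divr_gt0 // powR_gt0.
have cad := cadlag_stable.
rewrite /stay_prob !sup_abs_lt_bigcup ?(ltW t0) ?(ltW ta0) //.
under [in RHS]eq_bigcupr do rewrite mul1r.
pose F (s b : R) m := [set w | (sup_abs X s w <= (b * (1 - m.+1%:R^-1))%:E)%E].
have mF s b m : 0 < s -> measurable (F s b m).
  move=> s0; rewrite /F sup_abs_le_grid //.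
  by apply: bigcapT_measurable => n; exact: measurable_grid_event.
have FE m : P (F t a m) = P (F (t / a `^ alpha) 1 m).
  rewrite /F mul1r !sup_abs_le_grid //.
  have lim s c : 0 < s -> P (grid_event X s c n) @[n --> \oo] -->
      P (\bigcap_n grid_event X s c n).
    move=> s0; apply: nonincreasing_cvg_mu.
    - by rewrite ltey_eq fin_num_measure //; exact: measurable_grid_event.
    - by move=> n; exact: measurable_grid_event.
    - by apply: bigcapT_measurable => n; exact: measurable_grid_event.
    - exact: grid_event_nonincreasing.
  apply: cvg_unique (lim _ _ t0) _ => //.
  by rewrite (funext (fun n => grid_event_scaling _ n t0 a0)); exact: lim.
have limF s b : 0 < s -> 0 <= b -> P (F s b m) @[m --> \oo] --> P (\bigcup_m F s b m).
  move=> s0 b0; apply: nondecreasing_cvg_mu.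
  - by move=> m; exact: mF.
  - by apply: bigcupT_measurable => m; exact: mF.
  - move=> m n mn; apply/subsetPset => w /le_trans; apply.
    by rewrite lee_fin ler_wpM2l // lerD2l lerN2 lef_pV2 ?posrE ?ltr0n // ler_nat.
have := limF t a t0 (ltW a0); rewrite (funext FE) => l1.
have := cvg_unique _ l1 (limF _ _ ta0 ler01) => -> //.
by rewrite /F; under eq_bigcupr do rewrite mul1r.
Qed.

End scaling.

(** * Continuity in time of the probability of staying in ]-1, 1[ *)

Section continuity.
Context (R : realType).

Lemma measurable_gt_abs (d' : measure_display) (T' : measurableType d')
    (U : T' -> R) (e : R) : measurable_fun [set: T'] U ->
  measurable_fun [set: T'] (fun w => e < `|U w|).
Proof. by move=> mU; apply: measurable_fun_ltr => //; exact: measurableT_comp. Qed.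

Lemma measurable_gt_abs_set (d' : measure_display) (T' : measurableType d')
    (U : T' -> R) (e : R) : measurable_fun [set: T'] U ->
  measurable [set w | e < `|U w|].
Proof.
by move=> /(measurable_gt_abs e)/(_ measurableT [set true] I); rewrite setTI.
Qed.

(** Monotonicity squeezes [f] near [T] between its values at one point on each side. On the left the
    index starts at 2 because [1 - 1 / 1] would give the time 0, where [f] is not controlled. *)
Lemma nonincreasing_cvg_at (f : R -> R) (T : R) : 0 < T ->
  (forall s s', 0 < s -> s <= s' -> f s' <= f s) ->
  f (T * (1 - n.+2%:R^-1)) @[n --> \oo] --> f T ->
  f (T * (1 + n.+1%:R^-1)) @[n --> \oo] --> f T ->
  f s @[s --> T] --> f T.
Proof.
move=> T0 fn fl fr; apply/cvgrPdist_le => e e0.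
move/cvgrPdist_le : fl => /(_ e e0)[n _ /(_ n (leqnn n)) /= hl].
move/cvgrPdist_le : fr => /(_ e e0)[m _ /(_ m (leqnn m)) /= hr].
have vn : n.+2%:R^-1 < 1 :> R by rewrite invf_lt1 ?ltr0n // ltr1n.
have lT : T * (1 - n.+2%:R^-1) < T by rewrite gtr_pMr // gtrBl invr_gt0 ltr0n.
have Tr : T < T * (1 + m.+1%:R^-1) by rewrite ltr_pMr // ltrDl invr_gt0 ltr0n.
have l0 : 0 < T * (1 - n.+2%:R^-1) by rewrite mulr_gt0 // subr_gt0.
near=> s.
have ls : T * (1 - n.+2%:R^-1) <= s by near: s; exact: lt_le_nbhsr.
have sr : s <= T * (1 + m.+1%:R^-1) by near: s; exact: lt_le_nbhsl.
have := fn _ _ l0 ls; have := fn _ _ (lt_le_trans l0 ls) sr.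
move: hl hr; rewrite !ler_norml => /andP[? ?] /andP[? ?] ? ?; lra.
Unshelve. all: end_near. Qed.

Context (d : measure_display) (Omega : measurableType d).
Variables (P : probability Omega R) (X : R -> {RV P >-> R}).
Variables (alpha beta : R).
Hypothesis hX : stable_process X alpha beta.
Hypothesis hab : alpha = 1 -> beta = 0.
Hypothesis alpha0 : 0 < alpha.

Definition stay (s : R) : set Omega := [set w | (sup_abs X s w < 1%:E)%E].

Lemma measurable_stay (s : R) : 0 < s -> measurable (stay s).
Proof. by move=> s0; exact: (measurable_sup_abs_lt (cadlag_stable hX)). Qed.

Lemma stay_nonincreasing (s s' : R) : s <= s' -> stay s' `<=` stay s.
Proof.
move=> ss' w; apply: le_lt_trans; apply/sup_abs_leP => u /andP[u0 us].
by apply: ereal_sup_ubound; exists u => //=; rewrite in_itv /= u0 (le_trans us).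
Qed.

(** The uniform [r] matters: a cadlag path can approach 1 at a left limit without reaching it, and
    its supremum is then 1. *)
Lemma stay_pathP (s : R) (w : Omega) : 0 <= s ->
  stay s w <-> exists2 r, r < 1 & forall u, 0 <= u <= s -> `|X u w| <= r.
Proof.
move=> s0; split.
  move=> sw; have : [set w | (sup_abs X s w < 1%:E)%E] w by [].
  rewrite sup_abs_lt_bigcup // => -[m _ /= /sup_abs_leP h].
  exists (1 * (1 - m.+1%:R^-1)); last by move=> u /h; rewrite lee_fin.
  by rewrite mul1r gtrBl invr_gt0 ltr0n.
move=> [r r1 h]; apply: le_lt_trans (_ : (r%:E < 1%:E)%E); last by rewrite lte_fin.
by apply/sup_abs_leP => u /h; rewrite lee_fin.
Qed.

(** By right continuity at [T], a path bounded away from 1 up to [T] remains so for a short time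
    afterwards. *)
Lemma stay_right_bigcup (T : R) : 0 < T ->
  stay T = \bigcup_n stay (T * (1 + n.+1%:R^-1)).
Proof.
move=> T0; apply/seteqP; split=> w; last first.
  move=> [n _]; apply: stay_nonincreasing.
  by rewrite ler_pMr // lerDl invr_ge0 ler0n.
move=> /(stay_pathP _ (ltW T0)) [r r1 hr].
have XT : `|X T w| < 1 by apply: le_lt_trans r1; apply: hr; rewrite lexx ltW.
(* The midpoint leaves room on both sides: above [|X T|] for continuity, below 1 for the uniform
   bound. *)
pose r' := (1 + `|X T w|) / 2.
have [r'1 Xr'] : r' < 1 /\ `|X T w| < r' by rewrite /r'; lra.
have [/(_ T (ltW T0)) rc _] := cadlag_stable hX w.
have [e /= e0 he] : \forall u \near T^'+, `|X u w| < r'.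
  by apply: (cvgr_lt `|X T w|) Xr'; exact: cvg_norm.
pose n := Num.truncn (T / e).
have ne : T * n.+1%:R^-1 < e.
  rewrite ltr_pdivrMr ?ltr0n // mulrC -ltr_pdivrMr //.
  exact/real_truncnS_gt/num_real.
exists n => //; apply/stay_pathP.
  by rewrite mulr_ge0 ?ltW // ltr_pwDl // invr_ge0 ler0n.
exists (Num.max r r'); first by rewrite gt_max r1.
move=> u /andP[u0 uT]; have [uT'|Tu] := leP u T.
  by rewrite le_max hr // u0.
rewrite le_max (ltW (he _ _ Tu)) ?orbT //=.
rewrite ltr0_norm ?subr_lt0 // opprB ltrBlDl; apply: le_lt_trans uT _.
by rewrite mulrDr mulr1 ltrD2l.
Qed.

(** By scaling, [X (h n)] has the law of [h n ^ (1 / alpha) * X 1], which tends to 0 at every sample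
    point; dominated convergence then applies to the indicators. *)
Lemma stable_small_time (h : nat -> R) (e : R) : 0 < e -> (forall n, 0 < h n) ->
  h n @[n --> \oo] --> 0 ->
  P [set w | e < `|X (h n) w|] @[n --> \oo] --> 0%E.
Proof.
move=> e0 h0 hh; pose c n := h n `^ alpha^-1.
have c0 n : 0 < c n by exact: powR_gt0.
have cE n : c n `^ alpha = h n.
  by rewrite /c -powRrM mulVf ?gt_eqF // powRr1 // ltW.
have PE n : P [set w | e < `|X (h n) w|] = P [set w | e < `|c n * X 1 w|].
  have mA : measurable [set x : R | e < `|x|].
    exact: measurable_gt_abs_set (@measurable_id _ _ _).
  by have := stable_scaling hX hab ler01 (c0 n) mA; rewrite mul1r cE.
rewrite (funext PE).
have mU n : measurable_fun [set: Omega] (fun w => c n * X 1 w).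
  by apply: measurable_funM => //; exact: measurable_cst.
have mb n := measurable_gt_abs e (mU n).
have lim : \int[P]_w ((e < `|c n * X 1 w|)%R%:R : R) @[n --> \oo] --> \int[P]_w (0 : R).
  apply: (@bounded_cvg_Rintegral _ _ _ _ _ _ 1).
  - by move=> n; exact: (@measurableT_comp _ _ _ _ _ _ (fun b : bool => b%:R : R)).
  - by move=> n w; case: (_ < _)%R; rewrite ?normr1 ?normr0.
  - move=> w; apply: cvg_near_cst.
    have cw : `|c n * X 1 w| @[n --> \oo] --> 0.
      rewrite -[X in _ --> X](normr0 R); apply: cvg_norm.
      rewrite -[X in _ --> X](mul0r (X 1 w)); apply: cvgM; last exact: cvg_cst.
      apply/cvgrPdist_lt => r r0.
      have rr0 : 0 < r `^ alpha by exact: powR_gt0.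
      move/cvgrPdist_lt : hh => /(_ _ rr0); apply: filterS => n.
      rewrite !sub0r !normrN !gtr0_norm // -[h n]cE => hr.
      rewrite ltNge; apply/negP => rc; move: hr; rewrite ltNge => /negP; apply.
      by apply: ge0_ler_powR; rewrite ?nnegrE ?(ltW alpha0) ?(ltW r0) ?(ltW (c0 n)).
    move/cvgrPdist_lt : cw => /(_ e e0); apply: filterS => n.
    by rewrite sub0r normrN normr_id => /ltW; rewrite leNgt => /negPf ->.
rewrite Rintegral_cst // mul0r in lim.
have -> : (fun n => P [set w | e < `|c n * X 1 w|]) =
    (fun n => (\int[P]_w ((e < `|c n * X 1 w|)%R%:R : R))%:E).
  apply/funext => n; rewrite (@Rintegral_bool _ _ _ P (fun w => e < `|c n * X 1 w|)) //.
  by rewrite fineK // fin_num_measure //; exact: measurable_gt_abs_set.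
by apply: cvg_EFin; [exact: nearW|exact: lim].
Qed.

(* No fixed discontinuity at [T]: [X T - X (s n)] is distributed like
   [X (T - s n)], which tends to 0 in probability. *)
Lemma left_limit_null (T : R) (s : nat -> R) : (forall n, 0 < s n < T) ->
  s n @[n --> \oo] --> T ->
  exists N, [/\ measurable N, P N = 0%E &
    forall w, ~ N w -> forall l, X (s n) w @[n --> \oo] --> l -> l = X T w].
Proof.
move=> hs sT.
pose B k n := [set w | k.+1%:R^-1 < `|X T w - X (s n) w|].
have mB k n : measurable (B k n).
  by apply: measurable_gt_abs_set; exact: measurable_funB.
(* On [D k m] the distance to [X T] exceeds [1 / (k + 1)] for all [n >= m]. Its probability is at
   most every [P (B k n)] with [n >= m], hence 0, and a limit other than [X T] puts the path into
   some [D k m]. *)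
pose D k m := \bigcap_(n in [set n | (m <= n)%N]) B k n.
have mD k m : measurable (D k m) by exact: bigcap_measurableType.
have PB k : P (B k n) @[n --> \oo] --> 0%E.
  have PE n : P (B k n) = P [set w | k.+1%:R^-1 < `|X (T - s n) w|].
    have /andP[s0 snT] := hs n.
    have mA : measurable [set x : R | k.+1%:R^-1 < `|x|].
      exact: measurable_gt_abs_set (@measurable_id _ _ _).
    have [[_ _ hom _] _] := hX.
    have := hom (s n) (T - s n) _ (ltW s0) _ mA; rewrite subrKC => <- //.
    by rewrite subr_ge0 ltW.
  rewrite (funext PE); apply: stable_small_time => [|n|].
  - by rewrite invr_gt0 ltr0n.
  - by rewrite subr_gt0; have /andP[] := hs n.
  - by rewrite -[X in _ --> X](subrr T); apply: cvgB => //; exact: cvg_cst.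
have D0 k m : P (D k m) = 0%E.
  apply/eqP; rewrite eq_le measure_ge0 andbT.
  apply: cvge_to_ge (PB k) _; near=> n.
  apply: le_measure; rewrite ?inE //.
  by move=> w; apply; rewrite /=; near: n; exact: nbhs_infty_ge.
have mN : measurable (\bigcup_k \bigcup_m D k m).
  by apply: bigcupT_measurable => k; exact: bigcupT_measurable.
exists (\bigcup_k \bigcup_m D k m); split.
- exact: mN.
- apply/negligibleP => //; apply: negligible_bigcup => k.
  by apply: negligible_bigcup => m; apply/negligibleP; [exact: mD|exact: D0].
- move=> w Nw l sl; apply/eqP; rewrite eq_sym -subr_eq0 -normr_eq0 eq_le normr_ge0 andbT.
  rewrite leNgt; apply/negP => gt0; apply: Nw.
  pose k := Num.truncn (`|X T w - l|^-1).
  have kl : k.+1%:R^-1 < `|X T w - l|.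
    rewrite invf_plt ?posrE ?ltr0n //; exact/real_truncnS_gt/num_real.
  have [m _ hm] : \forall n \near \oo, k.+1%:R^-1 < `|X T w - X (s n) w|.
    apply: (cvgr_gt `|X T w - l|) kl; apply: cvg_norm; apply: cvgB => //.
    exact: cvg_cst.
  by exists k => //; exists m => // n; exact: hm.
Unshelve. all: end_near. Qed.

(** Almost surely the left limit at [T] is [X T], and its absolute value is not 1. As a limit of
    values below 1 in absolute value it is then strictly below 1, which bounds the path away from 1
    up to and including [T]. *)
Lemma stay_left_bigcap (T : R) : 0 < T ->
  P (\bigcap_n stay (T * (1 - n.+2%:R^-1))) = P (stay T).
Proof.
move=> T0; pose s n := T * (1 - n.+2%:R^-1).
have s_itv n : 0 < s n < T.
  have v1 : n.+2%:R^-1 < 1 :> R by rewrite invf_lt1 ?ltr0n // ltr1n.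
  by rewrite mulr_gt0 ?subr_gt0 //= gtr_pMr // gtrBl invr_gt0 ltr0n.
have sT : s n @[n --> \oo] --> T.
  suff : s n @[n --> \oo] --> T * (1 - 0) by rewrite subr0 mulr1.
  apply: cvgM; first exact: cvg_cst.
  apply: cvgB; first exact: cvg_cst.
  by have := @cvg_harmonic R; rewrite -cvg_shiftS.
have [N [mN N0 hN]] := left_limit_null s_itv sT.
pose atom c := [set w | X T w = c].
have matom c : measurable (atom c).
  by have := measurable_funP (X T) measurableT _ (measurable_set1 c); rewrite setTI.
have mS : measurable (\bigcap_n stay (s n)).
  by apply: bigcapT_measurable => n; apply: measurable_stay; have /andP[] := s_itv n.
apply/eqP; rewrite eq_le; apply/andP; split; last first.
  apply: le_measure; rewrite ?inE //; first exact: measurable_stay.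
  move=> w sw n _; apply: stay_nonincreasing sw.
  by have /andP[_ /ltW] := s_itv n.
(* The exceptional paths are those that may jump at [T] and those with [X T = 1] or [X T = -1]. *)
apply: (@le_measure_null _ _ _ _ _ _ (N `|` (atom 1 `|` atom (-1)))) => //.
- exact: measurable_stay.
- by apply: measurableU => //; exact: measurableU.
- rewrite measureU0 //; first exact: measurableU.
  by rewrite measureU0 //; exact: stable_no_atom hX hab _ _ alpha0 T0.
move=> w hw; have [Nw|Nw] := pselect ((N `|` (atom 1 `|` atom (-1))) w); [by right|left].
have [_ /(_ T T0) hl] := cadlag_stable hX w.
set l := lim _ in hl.
have sl : X (s n) w @[n --> \oo] --> l.
  move/cvg_at_leftP : (hl); apply; split=> // n.
  by have /andP[] := s_itv n.
have lE : l = X T w by apply: (hN w) => // Nw'; apply: Nw; left.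
have l1 : `|l| < 1.
  rewrite lt_neqAle; apply/andP; split.
    apply/eqP => l1; apply: Nw; right; rewrite /atom /= -lE.
    have [l0|l0] := leP 0 l; [left|right]; rewrite -l1.
      by rewrite ger0_norm.
    by rewrite ltr0_norm // opprK.
  have cn : `|X (s n) w| @[n --> \oo] --> `|l| by apply: cvg_norm.
  rewrite -(cvg_lim _ cn) //; apply: limr_le; first exact: cvgP cn.
  apply: nearW => n; have /andP[sn0 _] := s_itv n.
  have /(stay_pathP _ (ltW sn0)) [r r1 hr] := hw n I.
  by apply: le_trans (ltW r1); apply: hr; rewrite lexx ltW.
pose r' := (1 + `|l|) / 2.
have [r'1 lr'] : r' < 1 /\ `|l| < r' by rewrite /r'; lra.
have [e /= e0 he] : \forall u \near T^'-, `|X u w| < r'.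
  by apply: (cvgr_lt `|l|) lr'; apply: cvg_norm.
have [n _ /(_ n (leqnn n)) /= hn] : \forall n \near \oo, T - e < s n.
  by apply: (cvgr_gt T) sT _ _; rewrite gtrBl.
have /andP[sn0 snT] := s_itv n.
have /(stay_pathP _ (ltW sn0)) [r r1 hr] := hw n I.
apply/stay_pathP; first exact: ltW.
exists (Num.max r r'); first by rewrite gt_max r1.
move=> u /andP[u0 uT]; have [us|su] := leP u (s n).
  by rewrite le_max hr // u0.
rewrite le_max; move: uT; rewrite le_eqVlt => /predU1P[->|uT].
  by rewrite -lE (ltW lr') orbT.
rewrite (ltW (he _ _ uT)) ?orbT //=.
by rewrite gtr0_norm ?subr_gt0 // ltrBlDr -ltrBlDl (lt_trans hn).
Qed.

(** The events decrease in time, so continuity of the measure along one sequence on each side of [T]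
    suffices. *)
Lemma stay_prob_continuous (T : R) : 0 < T ->
  stay_prob X s 1 @[s --> T] --> stay_prob X T 1.
Proof.
move=> T0; have fin s : 0 < s -> P (stay s) \is a fin_num.
  by move=> s0; rewrite fin_num_measure //; exact: measurable_stay.
have l0 n : 0 < T * (1 - n.+2%:R^-1).
  by rewrite mulr_gt0 // subr_gt0 invf_lt1 ?ltr0n // ltr1n.
have r0 n : 0 < T * (1 + n.+1%:R^-1).
  by rewrite mulr_gt0 // addr_gt0 // invr_gt0 ltr0n.
have cvg_fine : fine (P (stay s)) @[s --> T] --> fine (P (stay T)).
  apply: (@nonincreasing_cvg_at (fun s => fine (P (stay s)))) => //.
  - move=> s s' s0 ss'; have s'0 := lt_le_trans s0 ss'.
    apply: fine_le; rewrite ?fin //; apply: le_measure; rewrite ?inE;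
      by [exact: measurable_stay|exact: stay_nonincreasing].
  - apply: fine_cvg; rewrite fineK ?fin // -stay_left_bigcap //.
    apply: nonincreasing_cvg_mu.
    + by rewrite ltey_eq fin.
    + by move=> n; exact: measurable_stay.
    + by apply: bigcapT_measurable => n; exact: measurable_stay.
    + move=> m n mn; apply/subsetPset/stay_nonincreasing.
      by rewrite ler_pM2l // lerD2l lerN2 lef_pV2 ?posrE ?ltr0n // ler_nat.
  - apply: fine_cvg; rewrite fineK ?fin // stay_right_bigcup //.
    apply: nondecreasing_cvg_mu.
    + by move=> n; exact: measurable_stay.
    + by apply: bigcupT_measurable => n; exact: measurable_stay.
    + move=> m n mn; apply/subsetPset/stay_nonincreasing.
      by rewrite ler_pM2l // lerD2l lef_pV2 ?posrE ?ltr0n // ler_nat.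
have TE : stay_prob X T 1 = (fine (P (stay T)))%:E by rewrite fineK // fin.
rewrite TE; apply: cvg_EFin; last exact: cvg_fine.
by near=> s; apply: fin; near: s; exact: lt_nbhsr.
Unshelve. all: end_near. Qed.

End continuity.

Theorem corollary3p4 (R : realType) (d : measure_display)
    (Omega : measurableType d) (P : probability Omega R)
    (alpha beta : R) (X : R -> {RV P >-> R}) (a : R -> R) (T : R)
    (hpar : [\/ [/\ 0 < alpha, alpha < 2, alpha != 1, -1 < beta & beta < 1],
                [/\ 1 < alpha, alpha < 2 & (beta = 1 \/ beta = -1)] |
                (alpha = 1 /\ beta = 0)])
    (hX : stable_process X alpha beta)
    (ha : forall t, 0 < t -> 0 < a t)
    (hT : 0 < T)
    (hlim : t / (a t `^ alpha) @[t --> +oo] --> T) :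
  stay_prob X t (a t) @[t --> +oo] --> stay_prob X T 1.
Proof.
(* Each of the three parameter ranges gives a positive index and strict stability. *)
have [alpha0 hab] : 0 < alpha /\ (alpha = 1 -> beta = 0).
  case: hpar => [[a0 _ /eqP a1 _ _]|[a1 _ _]|[-> ->]] //.
  by split; [exact: lt_trans a1|move=> aE; rewrite aE ltxx in a1].
have comp : stay_prob X (t / (a t `^ alpha)) 1 @[t --> +oo] --> stay_prob X T 1.
  exact: (cvg_comp _ _ hlim (stay_prob_continuous hX hab alpha0 hT)).
(* The scaling identity concerns [t > 0], which holds eventually. *)
apply: cvg_trans comp; apply: near_eq_cvg; near=> t.
have t0 : 0 < t by near: t; exact: nbhs_pinfty_gt.
by rewrite -(stay_prob_scaling hX hab t0 (ha t t0)).
Unshelve. all: end_near. Qed.
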